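(* Let $\lambda\in\mathbb{R}$, let $Y$ be a Poisson random variable with parameter $\alpha>0$, and let $x\in[0,1]$. For all integers $n\ge k\ge 0$, \[ \frac{B_{k,n}^{Y}(x|\lambda)}{k!}=\binom{x}{k}_{\lambda}\binom{n}{k}\sum_{j=0}^{n-k}\alpha^{j}(1-x)^{j}{n-k \brace j}_{\lambda}. \]
   Context: For $\lambda\in\mathbb{R}$, $(x)_{0,\lambda}=1$, $(x)_{n,\lambda}=x(x-\lambda)\cdots(x-(n-1)\lambda)$ for $n\ge1$, $\binom{x}{k}_\lambda=\frac{(x)_{k,\lambda}}{k!}$, and $e_\lambda^x(t)=\sum_{n\ge0}(x)_{n,\lambda}\frac{t^n}{n!}$. The degenerate Stirling numbers of the second kind are given by $(x)_{n,\lambda}=\sum_{k=0}^n{n\brace k}_\lambda (x)_k$, where $(x)_k=x(x-1)\cdots(x-k+1)$. For the random variable $Y$, $E[e_\lambda^Y(t)]$ denotes the power series $\sum_{n\ge0}E[(Y)_{n,\lambda}]\frac{t^n}{n!}$ (constant term $1$); for real $a$, $(E[e_\lambda^Y(t)])^a=\sum_{j\ge0}\binom{a}{j}(E[e_\lambda^Y(t)]-1)^j$. The probabilistic degenerate Bernstein polynomials: $\frac{1}{k!}(x)_{k,\lambda}t^k(E[e_\lambda^Y(t)])^{1-x}=\sum_{n\ge k}B_{k,n}^{Y}(x|\lambda)\frac{t^n}{n!}$. *)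

(* Defs.v *)
From HB Require Import structures.
From mathcomp Require Import all_boot all_order all_algebra.
From mathcomp Require Import all_classical all_reals all_analysis.
From mathcomp Require Import ring lra zify.
Set Implicit Arguments.
Unset Strict Implicit.
Unset Printing Implicit Defensive.
Import Order.TTheory GRing.Theory Num.Theory.
Import numFieldNormedType.Exports.
Local Open Scope classical_set_scope.
Local Open Scope ring_scope.

Section Factorials.
Variable R : realType.
Implicit Types (lam x : R) (n k : nat).

(* (x)_k = x (x - 1) ... (x - k + 1) *)
Definition falling x k : R := \prod_(i < k) (x - i%:R).

(* (x)_{n,lam} = x (x - lam) ... (x - (n - 1) lam) *)
Definition dfalling lam x n : R := \prod_(i < n) (x - i%:R * lam).

Definition binomr x k : R := falling x k / k`!%:R.

Definition dbinom lam x k : R := dfalling lam x k / k`!%:R.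

End Factorials.

Section Stirling.
Variable R : realType.
Implicit Types (lam x : R) (n k : nat) (S : nat -> nat -> R).

(* The identity (x)_{n,lam} = \sum_k S n k (x)_k determines S n k only for
   k <= n; the entries above the diagonal are 0 by convention. *)
Definition is_dstirling2 lam S : Prop :=
  (forall n k, (n < k)%N -> S n k = 0) /\
  (forall n x, dfalling lam x n = \sum_(k < n.+1) S n k * falling x k).

Definition dstirling2 lam : nat -> nat -> R :=
  xget (fun _ _ => 0) [set S | is_dstirling2 lam S].

Lemma dstirling2_exists lam : exists S, is_dstirling2 lam S.
Proof.
pose fix S (n k : nat) {struct n} : R := match n with
  | 0%N => (k == 0%N)%:R
  | m.+1 => (if k is j.+1 then S m j else 0) + (k%:R - m%:R * lam) * S m k
  end.
have S0 n : forall k, (n < k)%N -> S n k = 0.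
  elim: n => [|n IH] [|k] //= nk.
  by rewrite !IH ?mulr0 ?addr0 // (leq_trans _ nk).
exists S; split=> // n x; elim: n => [|n IH].
  by rewrite /dfalling big_ord0 big_ord1 /= /falling big_ord0 mulr1.
have -> : dfalling lam x n.+1 = dfalling lam x n * (x - n%:R * lam).
  by rewrite /dfalling big_ord_recr.
rewrite IH big_distrl /=.
transitivity (\sum_(k < n.+1) (S n k * falling x k.+1)
   + \sum_(k < n.+1) ((k%:R - n%:R * lam) * S n k * falling x k)).
  rewrite -big_split /=; apply: eq_bigr => k _.
  have -> : falling x k.+1 = falling x k * (x - k%:R).
    by rewrite /falling big_ord_recr.
  by ring.
have -> : \sum_(k < n.+2) S n.+1 k * falling x k =
  \sum_(k < n.+2) (if nat_of_ord k is j.+1 then S n j else 0) * falling x k +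
  \sum_(k < n.+2) (k%:R - n%:R * lam) * S n k * falling x k.
  by rewrite -big_split /=; apply: eq_bigr => k _; rewrite mulrDl.
congr (_ + _); first by rewrite [RHS]big_ord_recl /= mul0r add0r.
by rewrite [RHS]big_ord_recr /= S0 // mulr0 mul0r addr0.
Qed.

Lemma dstirling2P lam : is_dstirling2 lam (dstirling2 lam).
Proof. exact: (xgetPex _ (dstirling2_exists lam)). Qed.

Lemma falling_gt (m k : nat) : (m < k)%N -> falling (m%:R : R) k = 0.
Proof.
by move=> mk; rewrite /falling (bigD1 (Ordinal mk)) //= subrr mul0r.
Qed.

Lemma falling_diag (m : nat) : falling (m%:R : R) m != 0.
Proof.
apply/prodf_neq0 => i _; rewrite subr_eq0 eqr_nat.
by rewrite gtn_eqF.
Qed.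

Lemma dstirling2_unique lam S1 S2 :
  is_dstirling2 lam S1 -> is_dstirling2 lam S2 -> S1 = S2.
Proof.
move=> [Z1 H1] [Z2 H2]; apply/funext => n; apply/funext => k.
elim/ltn_ind: k => k IH.
case: (ltnP n k) => nk; first by rewrite Z1 // Z2.
have := H1 n k%:R; rewrite (H2 n k%:R).
have kn : (k < n.+1)%N by [].
rewrite (bigD1 (Ordinal kn)) //= [RHS](bigD1 (Ordinal kn)) //=.
rewrite (eq_bigr (fun i : 'I_n.+1 => S1 n i * falling (k%:R : R) i)).
  by move=> /addIr /(mulIf (falling_diag k)).
move=> i ik; have [ltik|gtik|eqik] := ltngtP i k.
- by rewrite IH.
- by rewrite falling_gt // !mulr0.
- by move/eqP: ik; case; apply/val_inj.
Qed.

End Stirling.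

(* A formal power series \sum_n f n t^n is represented by its coefficient
   sequence f; exponential normalizations are made explicit where needed. *)
Section FormalPowerSeries.
Variable R : realType.
Implicit Types (f g : nat -> R) (a : R).

Definition fps1 : nat -> R := fun n => (n == 0%N)%:R.

Definition fpsXn (k : nat) : nat -> R := fun n => (n == k)%:R.

Definition fps_sub f g : nat -> R := fun n => f n - g n.

Definition fps_scale a f : nat -> R := fun n => a * f n.

Definition fps_mul f g : nat -> R :=
  fun n => \sum_(i < n.+1) f i * g (n - i)%N.

Definition fps_exp f (j : nat) : nat -> R := iter j (fps_mul f) fps1.

(* f^a = \sum_(j >= 0) binom(a, j) (f - 1)^j for f with constant term 1: the
   coefficient of t^n only involves j <= n (fps_exp_lt). *)
Definition fps_pow f a : nat -> R :=
  fun n => \sum_(j < n.+1) binomr a j * fps_exp (fps_sub f fps1) j n.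

Lemma fps_exp_lt f (j n : nat) :
  f 0%N = 1 -> (n < j)%N -> fps_exp (fps_sub f fps1) j n = 0.
Proof.
move=> f0; elim: j n => [//|j IH] n nj.
rewrite /fps_exp iterS -/(fps_exp _ j) /fps_mul.
apply: big1 => -[[|i] lei] _ /=.
  by rewrite /fps_sub /fps1 f0 eqxx subrr mul0r.
by rewrite IH ?mulr0 //; lia.
Qed.

End FormalPowerSeries.

Section ProbabilisticBernstein.
Context (d : measure_display) (T : measurableType d) (R : realType).
Variables (P : probability T R) (Y : {RV P >-> R}).

(* E[e_lam^Y(t)] = \sum_n E[(Y)_{n,lam}] t^n / n! *)
Definition expect_dexp (lam : R) : nat -> R :=
  fun n => fine ('E_P[fun w => dfalling lam (Y w) n])%E / n`!%:R.

(* B_{k,n}^Y(x|lam) is n! times the coefficient of t^n in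
   1/k! (x)_{k,lam} t^k (E[e_lam^Y(t)])^(1 - x). *)
Definition pdbernstein (lam : R) (k n : nat) (x : R) : R :=
  n`!%:R *
  fps_scale (k`!%:R^-1 * dfalling lam x k)
    (fps_mul (fpsXn R k) (fps_pow (expect_dexp lam) (1 - x))) n.

Definition poisson_RV (alpha : R) : Prop :=
  forall i : nat, P (Y @^-1` [set i%:R]) = (poisson_pmf alpha i)%:E.

Lemma expect_dexp0 (lam : R) : expect_dexp lam 0 = 1.
Proof.
rewrite /expect_dexp fact0 invr1 mulr1.
have -> : (fun w => dfalling lam (Y w) 0) = cst 1.
  by apply/funext => w; rewrite /dfalling big_ord0.
by rewrite expectation_cst.
Qed.

(* The series on the left-hand side has no term of degree < k. *)
Lemma pdbernstein_lt (lam : R) (k n : nat) (x : R) :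
  (n < k)%N -> pdbernstein lam k n x = 0.
Proof.
move=> nk; rewrite /pdbernstein /fps_scale /fps_mul big1 ?mulr0 // => i _.
by rewrite /fpsXn ltn_eqF ?mul0r // (leq_ltn_trans _ nk) // -ltnS.
Qed.

End ProbabilisticBernstein.

(* Main.v *)
Require Import Defs.
From HB Require Import structures.
From mathcomp Require Import all_boot all_order all_algebra.
From mathcomp Require Import all_classical all_reals all_analysis.
From mathcomp Require Import measurable_realfun.
From mathcomp Require Import ring.
Import Order.TTheory GRing.Theory Num.Theory.
Import numFieldNormedType.Exports.
Local Open Scope classical_set_scope.
Local Open Scope ring_scope.

(* With [e = e_lam^1(t)], a Poisson [Y] has [E[(Y)_j] = alpha^j], so
   [E[e_lam^Y(t)]] is the exponential generating series of the degenerate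
   Touchard polynomials [p_n(c) = \sum_j S_lam(n, j) c^j] at [c = alpha], that is
   [exp(alpha (e - 1))].  The recurrence
   [p_(n+1) = X (p_n + p_n') - n lam p_n] shows that these series multiply by
   adding [c], hence the [m]-th power of the series at [alpha] is the series at
   [m alpha] for every natural [m]; each coefficient of the [a]-th power being
   polynomial in [a], the same holds for [a = 1 - x]. *)

(** The difference vanishes at 0, ..., [size (p - q)] - 1, more distinct roots than its degree
    allows. *)
Lemma poly_eq_on_nat (R : numDomainType) (p q : {poly R}) :
  (forall m : nat, p.[m%:R] = q.[m%:R]) -> p = q.
Proof.
move=> pq; apply/eqP; rewrite -subr_eq0; apply/eqP.
apply: (@roots_geq_poly_eq0 _ _ [seq i%:R | i <- iota 0 (size (p - q))]).
- by apply/allP => _ /mapP[i _ ->]; rewrite rootE hornerD hornerN pq subrr.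
- by rewrite map_inj_uniq ?iota_uniq // => i j /eqP; rewrite eqr_nat => /eqP.
- by rewrite size_map size_iota.
Qed.

(** * Falling factorials and binomial coefficients with real upper index *)

Section FallingFactorials.
Variable R : realType.
Implicit Types (x a : R) (k : nat).

Lemma fallingS x k : falling x k.+1 = falling x k * (x - k%:R).
Proof. by rewrite /falling big_ord_recr. Qed.

Lemma fallingSl x k : falling (x + 1) k.+1 = (x + 1) * falling x k.
Proof.
rewrite /falling big_ord_recl /= subr0; congr (_ * _).
by apply: eq_bigr => i _; rewrite /bump /= natrD; ring.
Qed.

Lemma falling_ge0_nat (m k : nat) : 0 <= falling (m%:R : R) k.
Proof.
have [mk|km] := ltnP m k; first by rewrite falling_gt.
apply: prodr_ge0 => i _; rewrite subr_ge0 ler_nat.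
by rewrite ltnW // (leq_trans (ltn_ord i)).
Qed.

Lemma falling_nat_fact (m k : nat) :
  falling ((m + k)%:R : R) k * m`!%:R = (m + k)`!%:R.
Proof.
elim: k => [|k IH]; first by rewrite /falling big_ord0 mul1r addn0.
rewrite addnS -[(_.+1)%:R]natr1 fallingSl factS natrM -IH -natr1; ring.
Qed.

Lemma binomr0 a : binomr a 0 = 1.
Proof. by rewrite /binomr /falling big_ord0 fact0 divr1. Qed.

Lemma binomr0S k : binomr (0 : R) k.+1 = 0.
Proof. by rewrite /binomr (falling_gt _ (m := 0)) // mul0r. Qed.

(** Pascal's rule: the first factor is peeled off on the left, the last one on the right. *)
Lemma binomrS a k : binomr (a + 1) k.+1 = binomr a k.+1 + binomr a k.
Proof.
rewrite /binomr fallingSl fallingS factS natrM -natr1.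
have k1 : k%:R + 1 != 0 :> R by rewrite natr1 pnatr_eq0.
have kf : k`!%:R != 0 :> R by rewrite pnatr_eq0 -lt0n fact_gt0.
by field; rewrite k1 kf.
Qed.

End FallingFactorials.

(** * Real powers of formal power series *)

Section FpsPower.
Variable R : realType.
Implicit Types (f : nat -> R) (a : R) (n N : nat).

(** Since [f - 1] has no constant term, its powers beyond the [n]-th do not reach degree [n];
    coefficients of different degrees can thus share one summation range. *)
Lemma fps_pow_wide f a n N : f 0%N = 1 -> (n < N)%N ->
  fps_pow f a n = \sum_(j < N) binomr a j * fps_exp (fps_sub f (fps1 R)) j n.
Proof.
move=> f0 nN; rewrite /fps_pow.
rewrite (big_ord_widen _ (fun j => binomr a j * fps_exp (fps_sub f (fps1 R)) j n) nN).
rewrite big_mkcond; apply: eq_bigr => j _; case: ltnP => // nj.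
by rewrite fps_exp_lt ?mulr0.
Qed.

Lemma fps_pow0 f : f 0%N = 1 -> fps_pow f 0 = fps1 R.
Proof.
move=> f0; apply/funext => n; rewrite /fps_pow big_ord_recl binomr0 mul1r.
by rewrite big1 ?addr0 // => i _; rewrite binomr0S mul0r.
Qed.

(** With [f = 1 + h], multiplication by [h] shifts the binomial series by one index, and Pascal's
    rule recombines the two sums. *)
Lemma fps_powS f a : f 0%N = 1 ->
  fps_pow f (a + 1) = fps_mul f (fps_pow f a).
Proof.
move=> f0; apply/funext => n; set h := fps_sub f (fps1 R).
have -> : fps_mul f (fps_pow f a) n = fps_pow f a n + fps_mul h (fps_pow f a) n.
  rewrite /fps_mul /h /fps_sub.
  under [in RHS]eq_bigr do rewrite mulrBl.
  rewrite sumrB [X in _ - X]big_ord_recl /= /fps1 eqxx mul1r subn0.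
  rewrite [X in _ - (_ + X)]big1 => [|i _]; last by rewrite mul0r.
  by rewrite addr0 addrC subrK.
have -> : fps_mul h (fps_pow f a) n =
    \sum_(j < n.+1) binomr a j * fps_exp h j.+1 n.
  rewrite /fps_mul.
  transitivity (\sum_(i < n.+1) \sum_(j < n.+1)
      h i * (binomr a j * fps_exp h j (n - i)%N)).
    apply: eq_bigr => i _.
    rewrite (fps_pow_wide f a (n - i)%N n.+1) ?ltnS ?leq_subr //.
    by rewrite big_distrr.
  rewrite exchange_big /=; apply: eq_bigr => j _.
  by rewrite big_distrr /=; apply: eq_bigr => i _; rewrite mulrCA.
(* Cut at [n.+2], both series keep [n.+1] terms after [j = 0], matching the shifted sum. *)
rewrite !(fps_pow_wide f _ n n.+2) // -/h.
rewrite !(big_ord_recl n.+1) !binomr0 -addrA; congr (_ + _).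
by rewrite -big_split /=; apply: eq_bigr => i _; rewrite binomrS mulrDl.
Qed.

(* Both sides of the hypothesis being polynomial in the exponent, the rule
   extends from natural to real exponents. *)
Lemma fps_pow_poly f (q : nat -> {poly R}) : f 0%N = 1 ->
  (forall n (m : nat), fps_pow f m%:R n = (q n).[m%:R]) ->
  forall a n, fps_pow f a n = (q n).[a].
Proof.
move=> f0 fq a n.
pose p := \sum_(j < n.+1) ((j`!%:R^-1 * fps_exp (fps_sub f (fps1 R)) j n) *:
  \prod_(i < j) ('X - (i%:R)%:P)).
have pE b : p.[b] = fps_pow f b n.
  rewrite horner_sum; apply: eq_bigr => j _; rewrite hornerZ horner_prod.
  under eq_bigr do rewrite hornerXsubC.
  by rewrite /binomr /falling; ring.
by rewrite -pE; congr horner; apply: poly_eq_on_nat => m; rewrite pE fq.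
Qed.

End FpsPower.

(** * Degenerate Touchard polynomials and their generating series *)

Section DegenerateTouchard.
Variables (R : realType) (lam : R).
Implicit Types (c d : R) (n k : nat).

Fixpoint dtouchard n : {poly R} := if n is m.+1 then
  'X * (dtouchard m + (dtouchard m)^`()) - (m%:R * lam) *: dtouchard m else 1.

Lemma coef_dtouchardS n k : (dtouchard n.+1)`_k =
  (if k is j.+1 then (dtouchard n)`_j else 0)
  + (k%:R - n%:R * lam) * (dtouchard n)`_k.
Proof.
rewrite /= coefB coefXM coefZ; case: k => [|k] /=; first by ring.
by rewrite coefD coef_deriv -mulr_natr; ring.
Qed.

Lemma coef_dtouchard_gt n k : (n < k)%N -> (dtouchard n)`_k = 0.
Proof.
elim: n k => [|n IH] [|k] nk //; first by rewrite coef1.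
rewrite coef_dtouchardS !IH ?mulr0 ?addr0 //.
by rewrite (leq_trans _ nk).
Qed.

(** By uniqueness it suffices to check the defining identity, by induction with x - m lam = (x - j)
    + (j - m lam): the first summand raises [falling x j] to [falling x j.+1]. *)
Lemma dstirling2E n k : dstirling2 lam n k = (dtouchard n)`_k.
Proof.
pose S n k := (dtouchard n)`_k.
suff SP : is_dstirling2 lam S.
  by rewrite (dstirling2_unique (dstirling2P lam) SP).
split=> [m j|m x]; first exact: coef_dtouchard_gt.
elim: m => [|m IH].
  by rewrite /dfalling big_ord0 big_ord1 /S coef1 /falling big_ord0 mulr1.
have -> : dfalling lam x m.+1 = dfalling lam x m * (x - m%:R * lam).
  by rewrite /dfalling big_ord_recr.
rewrite IH big_distrl /= /S.
under [RHS]eq_bigr do rewrite coef_dtouchardS mulrDl.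
rewrite big_split /= [X in _ = X + _]big_ord_recl mul0r add0r /=.
rewrite [X in _ = _ + X]big_ord_recr /= coef_dtouchard_gt // mulr0 mul0r addr0.
rewrite -big_split; apply: eq_bigr => j _ /=.
by rewrite /bump /= fallingS; ring.
Qed.

Lemma horner_dtouchard n c :
  (dtouchard n).[c] = \sum_(j < n.+1) dstirling2 lam n j * c ^+ j.
Proof.
rewrite (@horner_coef_wide _ n.+1); last first.
  by apply/leq_sizeP => j nj; rewrite coef_dtouchard_gt.
by apply: eq_bigr => j _; rewrite dstirling2E.
Qed.

Lemma horner_dtouchard0 n : (dtouchard n).[0] = (n == 0%N)%:R.
Proof.
elim: n => [|n IH]; first by rewrite hornerC.
rewrite /= hornerD hornerN hornerZ hornerM hornerX mul0r IH.
by case: n {IH} => [|n] /=; ring.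
Qed.

Definition touchard_fps c n : R := (dtouchard n).[c] / n`!%:R.

Lemma touchard_fps_at0 : touchard_fps 0 = fps1 R.
Proof.
apply/funext => n; rewrite /touchard_fps horner_dtouchard0 /fps1.
by case: n => [|n]; rewrite ?divr1 ?mul0r.
Qed.

(** Coefficients of the derivative in [c], not in t. *)
Let dfps c n : R := (dtouchard n)^`().[c] / n`!%:R.

(** Coefficientwise form of (1 + lam t) dF/dt = c (F + dF/dc). *)
Let touchard_fpsS c n : n.+1%:R * touchard_fps c n.+1 =
  (c - n%:R * lam) * touchard_fps c n + c * dfps c n.
Proof.
rewrite /touchard_fps /dfps /= hornerD hornerN hornerZ hornerM hornerX hornerD.
rewrite factS natrM -natr1.
have k1 : n%:R + 1 != 0 :> R by rewrite natr1 pnatr_eq0.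
have kf : n`!%:R != 0 :> R by rewrite pnatr_eq0 -lt0n fact_gt0.
by field; rewrite k1 kf.
Qed.

Let fps_mulC (f g : nat -> R) n :
  \sum_(i < n.+1) f i * g (n - i)%N = \sum_(i < n.+1) g i * f (n - i)%N.
Proof.
rewrite (reindex_inj rev_ord_inj) /=; apply: eq_bigr => i _.
by rewrite subSS subKn ?leq_ord // mulrC.
Qed.

(* Differentiating the convolution rule in [c] gives the term needed by the
   recurrence [p_(n+1) = X (p_n + p_n') - n lam p_n]. *)
Let dfpsD n :
  (forall c d, touchard_fps (c + d) n =
     \sum_(i < n.+1) touchard_fps c i * touchard_fps d (n - i)) ->
  forall c d, dfps (c + d) n =
     \sum_(i < n.+1) dfps c i * touchard_fps d (n - i).
Proof.
move=> H c d.
(* For fixed [d], both sides of [H] are polynomials in the first argument; agreeing on the naturals,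
   they have equal derivatives. *)
pose p := n`!%:R^-1 *: (dtouchard n \Po ('X + d%:P)).
pose q := \sum_(i < n.+1) (touchard_fps d (n - i) / i`!%:R) *: dtouchard i.
have /(congr1 (fun r => r^`().[c])) : p = q.
  apply: poly_eq_on_nat => m.
  rewrite /p /q horner_sum !hornerE horner_comp !hornerE.
  have := H m%:R d; rewrite {1}/touchard_fps mulrC => ->.
  by apply: eq_bigr => i _; rewrite hornerZ /touchard_fps; ring.
rewrite /p /q derivZ deriv_comp derivD derivX derivC addr0 mulr1 hornerZ.
rewrite horner_comp hornerD hornerX hornerC raddf_sum horner_sum /=.
rewrite /dfps mulrC => ->.
by apply: eq_bigr => i _; rewrite derivZ hornerZ; ring.
Qed.

Lemma touchard_fpsD c d :
  touchard_fps (c + d) = fps_mul (touchard_fps c) (touchard_fps d).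
Proof.
apply/funext => n; rewrite /fps_mul; elim: n c d => [|n IH] c d.
  by rewrite big_ord1 /touchard_fps !hornerC fact0 !divr1 mulr1.
have n1 : n.+1%:R != 0 :> R by rewrite pnatr_eq0.
apply: (mulfI n1); rewrite touchard_fpsS.
(* Leibniz rule for the derivative in t of the product. *)
have -> : n.+1%:R * \sum_(i < n.+2) touchard_fps c i * touchard_fps d (n.+1 - i) =
   \sum_(i < n.+1) (i.+1%:R * touchard_fps c i.+1) * touchard_fps d (n - i)
 + \sum_(i < n.+1) touchard_fps c i * ((n - i).+1%:R * touchard_fps d (n - i).+1).
  transitivity (\sum_(i < n.+2) (i%:R * touchard_fps c i) * touchard_fps d (n.+1 - i)
     + \sum_(i < n.+2) touchard_fps c i * ((n.+1 - i)%:R * touchard_fps d (n.+1 - i))).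
    rewrite big_distrr -big_split /=; apply: eq_bigr => i _.
    by rewrite natrB ?leq_ord //; ring.
  rewrite [X in X + _]big_ord_recl [X in _ + X]big_ord_recr /= !mul0r add0r.
  rewrite subnn mul0r mulr0 addr0; congr (_ + _); apply: eq_bigr => i _.
  by rewrite subSn ?leq_ord.
have D1 := dfpsD n IH c d.
(* By symmetry the derivative may fall on either factor: [c] will multiply the form in [D1], and [d]
   the form in [D2]. *)
have D2 := dfpsD n IH d c; rewrite addrC fps_mulC in D2.
rewrite [(c + d) * _]mulrDl {1}D1 D2 IH !big_distrr -!big_split /=; apply: eq_bigr => i _.
rewrite !touchard_fpsS natrB ?leq_ord //; ring.
Qed.

Lemma fps_pow_touchard c a n :
  fps_pow (touchard_fps c) a n = touchard_fps (a * c) n.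
Proof.
have f0 : touchard_fps c 0 = 1 by rewrite /touchard_fps hornerC fact0 divr1.
pose q n := n`!%:R^-1 *: (dtouchard n \Po (c *: 'X)).
have qE b m : (q m).[b] = touchard_fps (b * c) m.
  by rewrite /q hornerZ horner_comp !hornerE /touchard_fps mulrC [c * b]mulrC.
rewrite -qE; apply: fps_pow_poly => // {}n m; rewrite qE.
elim: m n => [|m IH] n; first by rewrite fps_pow0 // mul0r touchard_fps_at0.
rewrite -natr1 fps_powS // mulrDl mul1r [_ + c]addrC touchard_fpsD.
by rewrite /fps_mul; apply: eq_bigr => i _; rewrite IH.
Qed.

End DegenerateTouchard.

(** * Factorial moments of the Poisson mass function *)

Lemma sum_poisson_pmf (R : realType) (alpha : R) : 0 < alpha ->
  (\sum_(i <oo) (poisson_pmf alpha i)%:E = 1)%E.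
Proof.
move=> a0; rewrite nneseries_esumT; last first.
  by move=> i; rewrite lee_fin poisson_pmf_ge0.
have := probability_setT (poisson_prob alpha 0).
by rewrite /= /poisson_prob a0.
Qed.

(** The terms with [i < k] vanish; after shifting by [k], cancelling factorials leaves [alpha ^+ k]
    times the mass function. *)
Lemma sum_falling_poisson_pmf (R : realType) (alpha : R) (k : nat) :
  0 < alpha ->
  (\sum_(i <oo) (falling i%:R k * poisson_pmf alpha i)%:E = (alpha ^+ k)%:E)%E.
Proof.
move=> a0.
have ge0 i : (0 <= (falling i%:R k * poisson_pmf alpha i)%:E)%E.
  by rewrite lee_fin mulr_ge0 ?falling_ge0_nat ?poisson_pmf_ge0.
rewrite (nneseries_split 0 k) // big_nat big1 => [|i /andP[_ ik]]; last first.
  by rewrite falling_gt ?mul0r.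
rewrite add0e add0n -(nneseries_addn k) //.
transitivity (\sum_(i <oo) ((alpha ^+ k)%:E * (poisson_pmf alpha i)%:E))%E.
  apply: eq_eseriesr => i _; rewrite -EFinM /poisson_pmf a0; congr EFin.
  have := falling_nat_fact R i k.
  have f1 : i`!%:R != 0 :> R by rewrite pnatr_eq0 -lt0n fact_gt0.
  have f2 : (i + k)`!%:R != 0 :> R by rewrite pnatr_eq0 -lt0n fact_gt0.
  move=> fE; have fE' : falling (i + k)%:R k = (i + k)`!%:R / i`!%:R :> R.
    by rewrite -fE mulfK.
  by rewrite fE' exprD; field; rewrite f1 f2.
rewrite nneseriesZl; last by move=> i _; rewrite lee_fin poisson_pmf_ge0.
by rewrite sum_poisson_pmf // mule1.
Qed.

(** * Expectations under a Poisson random variable *)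

Section PoissonExpectation.
Context (d : measure_display) (T : measurableType d) (R : realType).
Variables (P : probability T R) (Y : {RV P >-> R}) (alpha : R).
Hypotheses (alpha_gt0 : 0 < alpha) (Y_poisson : poisson_RV Y alpha).

Let A (i : nat) : set T := Y @^-1` [set i%:R].

Let mA i : measurable (A i).
Proof. by rewrite -[A i]setTI; apply: measurable_funP. Qed.

Let trivA : trivIset setT A.
Proof.
apply/trivIsetP => i j _ _ ij; rewrite -subset0 => w [Yi Yj].
by move: ij; rewrite -(eqr_nat R) -Yi -Yj eqxx.
Qed.

Let measurable_bigcupA : measurable (\bigcup_i A i).
Proof. exact: bigcup_measurable. Qed.

(** Only the point masses of [Y] are given; they already sum to 1 over the disjoint events [A i]. *)
Lemma poisson_RV_nat_ae : P (~` \bigcup_i A i) = 0%E.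
Proof.
rewrite probability_setC // measure_bigcup //.
rewrite (_ : (\sum_(_ <oo | _) _)%E = 1%E) ?subee //.
rewrite -(sum_poisson_pmf R alpha) //.
rewrite (eq_eseriesl (Q := xpredT)) => [|i]; last by rewrite in_setT.
by apply: eq_eseriesr => i _; rewrite -Y_poisson.
Qed.

(** Up to a null set the space is the disjoint union of the [A i], and the integrand is constant on
    each. *)
Lemma ge0_integral_poisson_RV (f : R -> R) : measurable_fun setT f ->
  (forall y, 0 <= f y) ->
  (\int[P]_w (f (Y w))%:E = \sum_(i <oo) (f i%:R * poisson_pmf alpha i)%:E)%E.
Proof.
move=> mf f0.
have mfY : measurable_fun setT (fun w => (f (Y w))%:E).
  by apply/measurable_EFinP; apply: measurableT_comp.
rewrite (ge0_negligible_integral (measurableC measurable_bigcupA)) //; last 2 first.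
- by move=> w _; rewrite lee_fin.
- exact: poisson_RV_nat_ae.
rewrite setTD setCK ge0_integral_bigcup //; last 2 first.
- exact: measurable_funTS.
- by move=> w _; rewrite lee_fin.
apply: eq_eseriesr => i _.
rewrite (eq_integral (cst (f i%:R)%:E)) => [|w]; last first.
  by rewrite inE /A /= => ->.
by rewrite integral_cst // EFinM -Y_poisson.
Qed.

Lemma measurable_falling k : measurable_fun setT (fun y : R => falling y k).
Proof.
rewrite /falling; apply: measurable_prod => i _.
exact: measurable_funB.
Qed.

(** The transfer to a series requires a nonnegative integrand, and [falling] can be negative off the
    naturals; on them the absolute value changes nothing. *)
Let integral_abs_falling k :
  (\int[P]_w `|falling (Y w) k|%:E = (alpha ^+ k)%:E)%E.
Proof.
rewrite (ge0_integral_poisson_RV (fun y => `|falling y k|)) //; last first.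
  exact: measurableT_comp (measurable_falling k).
rewrite -sum_falling_poisson_pmf //; apply: eq_eseriesr => i _.
by rewrite ger0_norm // falling_ge0_nat.
Qed.

Let measurable_fallingY k : measurable_fun setT (fun w => (falling (Y w) k)%:E).
Proof.
apply/measurable_EFinP; exact: measurableT_comp (measurable_falling k) _.
Qed.

Lemma integrable_falling_poisson k :
  P.-integrable setT (fun w => (falling (Y w) k)%:E).
Proof.
apply/integrableP; split=> //.
by rewrite [ltLHS](integral_abs_falling k) ltry.
Qed.

Lemma integral_falling_poisson k :
  (\int[P]_w (falling (Y w) k)%:E = (alpha ^+ k)%:E)%E.
Proof.
rewrite -integral_abs_falling; apply: ae_eq_integral => //.
  apply/measurable_EFinP; apply: measurableT_comp => //.
  exact: measurableT_comp (measurable_falling k) _.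
exists (~` \bigcup_i A i); split.
- exact: measurableC.
- exact: poisson_RV_nat_ae.
- move=> w /=; apply: contra_not => -[i _ Yi] _.
  by rewrite Yi ger0_norm // falling_ge0_nat.
Qed.

(** The Stirling identity expands the integrand in ordinary falling factorials, whose expectations
    are the powers of [alpha]. *)
Lemma expectation_dfalling_poisson lam n : ('E_P[fun w => dfalling lam (Y w) n] =
  (\sum_(j < n.+1) dstirling2 lam n j * alpha ^+ j)%:E)%E.
Proof.
rewrite unlock.
rewrite (eq_integral (fun w => \sum_(j < n.+1)
    (dstirling2 lam n j)%:E * (falling (Y w) j)%:E)%E); last first.
  move=> w _; rewrite (dstirling2P lam).2 -sumEFin.
  by apply: eq_bigr => j _; rewrite EFinM.
rewrite integral_sum //; last first.
  by move=> j; apply: integrableZl => //; apply: integrable_falling_poisson.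
rewrite -sumEFin; apply: eq_bigr => j _.
rewrite integralZl //; last exact: integrable_falling_poisson.
by rewrite integral_falling_poisson EFinM.
Qed.

End PoissonExpectation.

(** * Coefficient extraction *)

Lemma fps_mulXn (R : realType) (k n : nat) (g : nat -> R) : (k <= n)%N ->
  fps_mul (fpsXn R k) g n = g (n - k)%N.
Proof.
move=> kn; have kn1 : (k < n.+1)%N by [].
rewrite /fps_mul (bigD1 (Ordinal kn1)) //= /fpsXn eqxx mul1r big1 ?addr0 //.
move=> i ik; rewrite (_ : (i == k :> nat) = false) ?mul0r //.
by apply/negbTE; move: ik; apply: contra => /eqP ik; apply/eqP/val_inj.
Qed.

Theorem theorem2p9 (d : measure_display) (T : measurableType d) (R : realType)
    (P : probability T R) (Y : {RV P >-> R}) (lam alpha x : R) (n k : nat)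
    (alpha_gt0 : 0 < alpha) (Y_poisson : poisson_RV Y alpha)
    (x01 : 0 <= x <= 1) (le_kn : (k <= n)%N) :
  pdbernstein Y lam k n x / k`!%:R =
  dbinom lam x k * 'C(n, k)%:R *
    \sum_(j < (n - k).+1)
      alpha ^+ j * (1 - x) ^+ j * dstirling2 lam (n - k)%N j.
Proof.
have EY : expect_dexp Y lam = touchard_fps R lam alpha.
  apply/funext => m; rewrite /expect_dexp (@expectation_dfalling_poisson _ _ _ _ _ alpha) //.
  by rewrite /touchard_fps horner_dtouchard.
(* The factor t^k lowers the degree to [n - k], and the power [1 - x] moves the series from [alpha]
   to [(1 - x) * alpha]. *)
rewrite /pdbernstein /fps_scale fps_mulXn // EY fps_pow_touchard.
rewrite /touchard_fps horner_dtouchard /dbinom.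
under [in RHS]eq_bigr do
  rewrite -exprMn [alpha * _]mulrC [_ * dstirling2 _ _ _]mulrC.
have fact_neq0 m : m`!%:R != 0 :> R by rewrite pnatr_eq0 -lt0n fact_gt0.
(* Writing n! as C(n, k) k! (n - k)! produces the binomial coefficient and cancels the remaining
   factorials. *)
rewrite -(bin_fact le_kn) !natrM.
by field; rewrite !fact_neq0.
Qed.
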